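(* Let $F_q$ be a finite field, let $n\geq 3$, and let $\mathbb{V}=F_q^n$ with standard basis $e_1,\dots,e_n$. Let $\mathcal{G}(\mathbb{V})$ be the subspace sum graph of $\mathbb{V}$, with vertex set $V$. A mapping $\sigma: V\to V$ is an automorphism of $\mathcal{G}(\mathbb{V})$ if and only if $\sigma=\sigma_A\circ\sigma_f$ for some invertible $n\times n$ matrix $A$ over $F_q$ and some field automorphism $f$ of $F_q$; moreover this decomposition is unique, in the sense that if $\sigma_{A_1}\circ\sigma_{f_1}=\sigma_{A_2}\circ\sigma_{f_2}$ then $\sigma_{A_1}=\sigma_{A_2}$ (as maps on $V$) and $\sigma_{f_1}=\sigma_{f_2}$.
   Context: The subspace sum graph $\mathcal{G}(\mathbb{V})$ of a finite-dimensional vector space $\mathbb{V}$ has as vertex set $V$ the set of all nontrivial proper subspaces of $\mathbb{V}$ (i.e., subspaces other than $\{0\}$ and $\mathbb{V}$), and two distinct vertices $W_1,W_2$ are adjacent iff $W_1+W_2=\mathbb{V}$. For an invertible $n\times n$ matrix $X=[x_{ij}]$ over $F_q$, $\sigma_X$ denotes the map $V\to V$ given by $\sigma_X(W)=\{\sigma_X(w): w\in W\}$ where $\sigma_X(\sum_i a_ie_i)=\sum_i(\sum_j x_{ij}a_j)e_i$. For a field automorphism $f$ of $F_q$, $\sigma_f$ denotes the map $V\to V$ given by $\sigma_f(W)=\{\sigma_f(w):w\in W\}$ where $\sigma_f(\sum_i b_ie_i)=\sum_i f(b_i)e_i$. *)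

(* Defs.v *)
From mathcomp Require Import all_boot all_order all_algebra.

Set Implicit Arguments.
Unset Strict Implicit.
Unset Printing Implicit Defensive.

Import GRing.Theory.
Local Open Scope ring_scope.

Section SubspaceSumGraph.

Variables (F : finFieldType) (n : nat).

Implicit Types (W : {vspace 'cV[F]_n}) (A : 'M[F]_n) (f : {rmorphism F -> F}).

Definition vertex : Type :=
  {W : {vspace 'cV[F]_n} | (W != 0%VS) && (W != fullv)}.

Definition sum_adj (U1 U2 : vertex) : bool :=
  (U1 != U2) && ((val U1 + val U2)%VS == fullv).

Definition graph_automorphism (s : vertex -> vertex) : Prop :=
  bijective s /\ forall U1 U2, sum_adj (s U1) (s U2) = sum_adj U1 U2.

(* The span only serves to package the image as a {vspace _}: by vimageE below,
   for semilinear g it is the plain set of the g w, w \in W. *)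
Definition vimage (g : 'cV[F]_n -> 'cV[F]_n) W : {vspace 'cV[F]_n} :=
  <<[seq g w | w in W]>>%VS.

Definition semilinear_along f (g : 'cV[F]_n -> 'cV[F]_n) : Prop :=
  forall a u v, g (a *: u + v) = f a *: g u + g v.

Lemma semilinear0 f g : semilinear_along f g -> g 0 = 0.
Proof.
move=> gL; have := gL 1 0 0; rewrite scaler0 addr0 rmorph1 scale1r => e.
by apply: (@addrI _ (g 0)); rewrite addr0 -e.
Qed.

Lemma vimageE f g W : bijective f -> semilinear_along f g ->
  forall v, (v \in vimage g W) = (v \in [set g w | w in W]).
Proof.
move=> [f' _ fK'] gL.
have g0 := semilinear0 gL.
move=> v; apply/idP/imsetP => [|[w wW ->]]; last first.
  by apply: memv_span; apply: image_f.
move=> /coord_span ->.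
elim/big_ind: _ => [|x y [u uW ->] [w wW ->]|i _].
- by exists 0; rewrite ?mem0v.
- exists (u + w); first exact: memvD.
  by rewrite -[u]scale1r gL rmorph1 !scale1r.
set c := coord _ _ _.
have /imageP[w wW ->] : nth 0 [seq g w | w in W] i \in [seq g w | w in W].
  by apply: mem_nth; rewrite size_image ltn_ord.
exists (f' c *: w); first exact: memvZ.
by rewrite -[f' c *: w]addr0 gL g0 addr0 fK'.
Qed.

Lemma vimage_vertex f g W : bijective f -> semilinear_along f g ->
  bijective g -> (W != 0%VS) && (W != fullv) ->
  (vimage g W != 0%VS) && (vimage g W != fullv).
Proof.
move=> fB gL gB /andP[W0 WT].
have mem v : (g v \in vimage g W) = (v \in W).
  rewrite (vimageE _ fB gL); apply/imsetP/idP => [[w wW /(bij_inj gB)->]|vW] //.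
  by exists v.
have g0 := semilinear0 gL.
apply/andP; split.
  apply: contraNneq W0 => E; rewrite -subv0; apply/subvP => v.
  by rewrite -mem E !memv0 -{1}g0 (inj_eq (bij_inj gB)).
apply: contraNneq WT => E; rewrite eqEsubv subvf /=.
by apply/subvP => v _; rewrite -mem E memvf.
Qed.

Definition vec_mx_fun A (w : 'cV[F]_n) : 'cV[F]_n := A *m w.

Definition vec_aut_fun f (w : 'cV[F]_n) : 'cV[F]_n := map_mx f w.

Lemma vec_mx_semilinear A : semilinear_along idfun (vec_mx_fun A).
Proof. by move=> a u v; rewrite /vec_mx_fun mulmxDr scalemxAr. Qed.

Lemma vec_aut_semilinear f : semilinear_along f (vec_aut_fun f).
Proof. by move=> a u v; rewrite /vec_aut_fun map_mxD map_mxZ. Qed.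

Lemma vec_mx_bij A : A \in unitmx -> bijective (vec_mx_fun A).
Proof.
by move=> hA; exists (vec_mx_fun (invmx A)); [exact: mulKmx | exact: mulKVmx].
Qed.

Lemma vec_aut_bij f : bijective f -> bijective (vec_aut_fun f).
Proof.
move=> [f' fK fK']; exists (map_mx f') => v; apply/matrixP => i j.
  by rewrite !mxE fK.
by rewrite !mxE fK'.
Qed.

Lemma id_bij : bijective (idfun : F -> F).
Proof. by exists idfun. Qed.

Definition sigma_mx A (hA : A \in unitmx) (U : vertex) : vertex :=
  exist _ (vimage (vec_mx_fun A) (val U))
    (vimage_vertex id_bij (@vec_mx_semilinear A) (vec_mx_bij hA) (valP U)).

Definition sigma_aut f (hf : bijective f) (U : vertex) : vertex :=
  exist _ (vimage (vec_aut_fun f) (val U))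
    (vimage_vertex hf (@vec_aut_semilinear f) (vec_aut_bij hf) (valP U)).

Lemma mem_sigma_mx A (hA : A \in unitmx) (U : vertex) v :
  (v \in val (sigma_mx hA U)) = (v \in [set A *m w | w in val U]).
Proof. exact: (vimageE _ id_bij (@vec_mx_semilinear A)). Qed.

Lemma mem_sigma_aut f (hf : bijective f) (U : vertex) v :
  (v \in val (sigma_aut hf U)) = (v \in [set map_mx f w | w in val U]).
Proof. exact: (vimageE _ hf (@vec_aut_semilinear f)). Qed.

End SubspaceSumGraph.

(* Main.v *)
(* For U1, U2 nontrivial proper, U1 <= U2 iff every neighbour of U1 is a
   neighbour of U2: if u is in U1 but not in U2, a hyperplane containing U2 but
   not u is a neighbour of U1 only. So a graph automorphism is a lattice
   automorphism, and the fundamental theorem of projective geometry applies.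
   For the latter, compose with a linear map so as to fix the lines spanned by
   the e_i and by e_1 + ... + e_n. Then every hyperplane x_i = a x_j is mapped to
   some hyperplane x_i = f(a) x_j; since n >= 3, f does not depend on i and j
   and is a field homomorphism, and the lattice automorphism is the coordinatewise
   action of f. For uniqueness, A_2^-1 A_1 has all e_i and e_1 + ... + e_n as
   eigenvectors, so it is a scalar matrix. *)
Require Import Defs.
From mathcomp Require Import all_boot all_order all_algebra.
From HB Require Import structures.

Set Implicit Arguments.
Unset Strict Implicit.
Unset Printing Implicit Defensive.

Import GRing.Theory.
Local Open Scope ring_scope.

(** * Bundling functions as ring morphisms *)

Lemma exists_rmorphism (R S : nzRingType) (f : R -> S) :
  zmod_morphism f -> monoid_morphism f -> exists f' : {rmorphism R -> S}, f' =1 f.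
Proof.
move=> fB fM.
pose fb := GRing.isZmodMorphism.Build R S f fB.
pose fm := GRing.isMonoidMorphism.Build R S f fM.
pose f' : {rmorphism R -> S} := HB.pack f fb fm.
by exists f'.
Qed.

Lemma exists_rmorphism_inv (R S : nzRingType) (f : {rmorphism R -> S}) :
  bijective f -> exists2 f' : {rmorphism S -> R}, cancel f f' & cancel f' f.
Proof.
move=> [f' fK f'K].
have [||f'' E] := @exists_rmorphism _ _ f'.
- exact: can2_zmod_morphism fK f'K.
- exact: can2_monoid_morphism fK f'K.
by exists f'' => x; rewrite E.
Qed.

(** * Hyperplanes and spans *)

Section Span.

Variables (K : fieldType) (vT : vectType K).
Implicit Types (U : {vspace vT}) (S : seq vT) (v : vT).

(** [H] is [U] plus a complement [C] of [<[v]> + U]. If [U + C] were everything, comparing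
    dimensions would give [<[v]> + U] the dimension of [U], hence [v] in [U]. *)
Lemma exists_hyperplane U v : v \notin U ->
  exists H : {vspace vT}, [/\ (U <= H)%VS, H != fullv & (<[v]> + H = fullv)%VS].
Proof.
move=> vU; pose C := ((<[v]> + U)^C)%VS.
have sumE : (<[v]> + (U + C) = fullv)%VS by rewrite addvA addv_complf.
exists (U + C)%VS; split; rewrite ?addvSl //.
apply: contraNneq vU => E.
have dU : (\dim (<[v]> + U) + \dim C = \dim {:vT})%N.
  by rewrite dimv_compl subnKC ?dimvS ?subvf.
have : (\dim (<[v]> + U) <= \dim U)%N.
  rewrite -(leq_add2r (\dim C)) dU -E; by rewrite dimv_add_leqif.
rewrite (geq_leqif (dimv_leqif_sup (addvSr _ _))) subv_add => /andP[].
by rewrite -memvE.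
Qed.

End Span.

(** The condition is linear in [v]; for [c = 0] it describes a coordinate hyperplane. *)
Lemma span_coord_ratio (K : fieldType) n (S : seq 'cV[K]_n) i j c :
  {in S, forall v : 'cV_n, v i 0 = c * v j 0} ->
  {in <<S>>%VS, forall v : 'cV_n, v i 0 = c * v j 0}.
Proof.
move=> Sc v /(@coord_span _ _ _ (in_tuple S)) ->.
rewrite !summxE mulr_sumr; apply: eq_bigr => k _.
by rewrite !mxE Sc ?mem_nth // mulrCA.
Qed.

(** * Images under semilinear bijections; inclusion in terms of adjacency *)

Section Semilinear.

Variables (F : finFieldType) (n : nat).
Implicit Types (f : {rmorphism F -> F}) (g : 'cV[F]_n -> 'cV[F]_n)
  (W : {vspace 'cV[F]_n}).

Lemma semilinear_inv f f' g g' : cancel f f' -> cancel f' f ->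
  cancel g g' -> cancel g' g -> semilinear_along f g -> semilinear_along f' g'.
Proof.
move=> fK f'K gK g'K gL a u v; apply: (can_inj gK).
by rewrite gL f'K !g'K.
Qed.

Lemma mem_vimage f g W v : bijective f -> semilinear_along f g -> injective g ->
  (g v \in vimage g W) = (v \in W).
Proof.
move=> fB gL gI; rewrite (vimageE _ fB gL); apply/imsetP/idP => [[w wW /gI->]|vW] //.
by exists v.
Qed.

Lemma vimageK f g g' W : bijective f -> semilinear_along f g ->
  cancel g g' -> cancel g' g -> vimage g' (vimage g W) = W.
Proof.
move=> fB gL gK g'K; have [f' fK f'K] := exists_rmorphism_inv fB.
have f'B : bijective f' by exists f.
apply/vspaceP => v; rewrite -{1}(gK v).
rewrite (mem_vimage _ _ f'B (semilinear_inv fK f'K gK g'K gL)) ?(mem_vimage _ _ fB gL) //.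
- exact: can_inj gK.
- exact: can_inj g'K.
Qed.

Lemma vimageD f g W1 W2 : bijective f -> semilinear_along f g ->
  vimage g (W1 + W2) = (vimage g W1 + vimage g W2)%VS.
Proof.
move=> fB gL; have gD u v : g (u + v) = g u + g v.
  by rewrite -[u in LHS]scale1r gL rmorph1 scale1r.
apply/vspaceP => v; rewrite (vimageE _ fB gL).
apply/imsetP/memv_addP => [[w /memv_addP[w1 w1W [w2 w2W ->]] ->]|].
  exists (g w1); first by rewrite (vimageE _ fB gL) imset_f.
  by exists (g w2); rewrite ?gD // (vimageE _ fB gL) imset_f.
move=> [v1]; rewrite (vimageE _ fB gL) => /imsetP[w1 w1W ->] [v2].
rewrite (vimageE _ fB gL) => /imsetP[w2 w2W ->] ->.
by exists (w1 + w2); rewrite ?gD ?memv_add.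
Qed.

Lemma vimage_full f g W : bijective f -> semilinear_along f g -> bijective g ->
  (vimage g W == fullv) = (W == fullv).
Proof.
move=> fB gL gB; apply/eqP/eqP => [E|->].
  apply/vspaceP => v; rewrite memvf.
  by rewrite -(mem_vimage _ _ fB gL (bij_inj gB)) E memvf.
have [g' gK g'K] := gB; apply/vspaceP => v.
by rewrite -(g'K v) (mem_vimage _ _ fB gL (bij_inj gB)) !memvf.
Qed.

(** Distinctness is automatic, since [W + W = W] is proper. *)
Lemma sum_adjE (U1 U2 : vertex F n) :
  sum_adj U1 U2 = (val U1 + val U2 == fullv)%VS.
Proof.
rewrite /sum_adj andb_idl // => /eqP E; apply/eqP => U12.
move: E; rewrite -U12 addvv => E.
by have /andP[_] := valP U1; rewrite E eqxx.
Qed.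

Lemma semilinear_graph_automorphism f g (s : vertex F n -> vertex F n) :
  bijective f -> semilinear_along f g -> bijective g ->
  (forall U, val (s U) = vimage g (val U)) -> graph_automorphism s.
Proof.
move=> fB gL gB sE; split; last first.
  by move=> U1 U2; rewrite !sum_adjE !sE -(vimageD _ _ fB gL) (vimage_full _ fB gL).
(* The inverse vertex map is induced by the inverse of [g], which is semilinear along the inverse of
   [f]. *)
have [g' gK g'K] := gB; have [f' fK f'K] := exists_rmorphism_inv fB.
have f'B : bijective f' by exists f.
have g'B : bijective g' by exists g.
have g'L := semilinear_inv fK f'K gK g'K gL.
exists (fun U => exist _ (vimage g' (val U)) (vimage_vertex f'B g'L g'B (valP U))) => U.
  by apply: val_inj; rewrite /= sE (vimageK _ fB gL).
by apply: val_inj; rewrite sE /= (vimageK _ f'B g'L).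
Qed.

Lemma vimage_comp f g h W : bijective f -> semilinear_along f g ->
  vimage h (vimage g W) = vimage (h \o g) W.
Proof.
move=> fB gL; apply/eqP; rewrite eqEsubv; apply/andP; split; apply/span_subvP => v.
  case/imageP=> w; rewrite (vimageE _ fB gL) => /imsetP[u uW ->] ->.
  by apply/memv_span/(image_f (h \o g)).
case/imageP=> w wW ->; apply/memv_span/image_f.
by rewrite (vimageE _ fB gL) imset_f.
Qed.

Lemma sigma_comp_automorphism (A : 'M[F]_n) (hA : A \in unitmx) f (hf : bijective f) :
  graph_automorphism (sigma_mx hA \o sigma_aut hf).
Proof.
apply: (@semilinear_graph_automorphism f (vec_mx_fun A \o vec_aut_fun f)) => //.
- by move=> a u v; rewrite /= (vec_aut_semilinear f) (vec_mx_semilinear A).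
- by apply: bij_comp; [exact: vec_mx_bij | exact: vec_aut_bij].
- by move=> U; rewrite /= (vimage_comp _ _ hf (vec_aut_semilinear f)).
Qed.

Lemma vertex_le (U1 U2 : vertex F n) :
  (val U1 <= val U2)%VS <-> (forall U, sum_adj U1 U -> sum_adj U2 U).
Proof.
split=> [U12 U | adj].
  rewrite !sum_adjE => /eqP E; rewrite eqEsubv subvf /=.
  by apply: subv_trans (addvS U12 (subvv (val U))); rewrite E.
apply/subvP => u uU1; apply/negPn/negP => /exists_hyperplane[H [U2H Hf uH]].
have vH : (H != 0%VS) && (H != fullv).
  rewrite Hf andbT; apply: contraTneq U2H => ->; rewrite subv0.
  by have /andP[] := valP U2.
have := adj (exist _ H vH); rewrite !sum_adjE /= (addv_idPr U2H).
rewrite (negbTE Hf) => /(_ _)/notF; apply.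
by rewrite eqEsubv subvf /=; apply: subv_trans (addvS uU1 (subvv H)); rewrite uH.
Qed.

End Semilinear.

(** * Collineations fixing the coordinate hyperplanes and the line of the all-ones vector *)

Section NormalizedCollineation.

Variables (K : fieldType) (m : nat) (h : 'cV[K]_m.+3 -> 'cV[K]_m.+3).
Hypothesis h_span : forall v S, v \in <<S>>%VS -> h v \in <<map h S>>%VS.
Hypothesis h_coord0 : forall v i, (h v i 0 == 0) = (v i 0 == 0).
Hypothesis h_normal : forall i, h (const_mx 1) i 0 = h (const_mx 1) 0 0.

Local Notation e i := (delta_mx i 0 : 'cV[K]_m.+3).

(** The slope of the image of the hyperplane x_i = a x_j, read off at the vector [e j + a *: e i].
    For [i != j] the denominator is nonzero by [h_coord0]. *)
Definition coord_ratio (i j : 'I_m.+3) (a : K) : K :=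
  h (e j + a *: e i) i 0 / h (e j + a *: e i) j 0.

(* A hyperplane [x_i = a x_j] is spanned by [e_j + a e_i] and the other basis
   vectors, so [h] sends it into a hyperplane of the same form. *)
Lemma coord_ratioP (i j : 'I_m.+3) (a : K) (v : 'cV[K]_m.+3) : i != j -> v i 0 = a * v j 0 ->
  h v i 0 = coord_ratio i j a * h v j 0.
Proof.
move=> ij vij; pose S := (e j + a *: e i) ::
  [seq e k | k <- enum [pred k | (k != i) && (k != j)]].
have vS : v \in <<S>>%VS.
  have -> : v = v j 0 *: (e j + a *: e i) +
      \sum_(k | (k != i) && (k != j)) v k 0 *: e k.
    apply/colP => l; rewrite !mxE ?eqxx ?andbT summxE.
    have [->|li] := eqVneq l i.
      rewrite big1 => [|k /andP[/negbTE ki _]]; last first.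
        by rewrite !mxE ?eqxx ?andbT eq_sym ki mulr0.
      by rewrite (negbTE ij) add0r addr0 mulr1 mulrC -vij.
    have [->|lj] := eqVneq l j.
      rewrite big1 => [|k /andP[_ /negbTE kj]]; last first.
        by rewrite !mxE ?eqxx ?andbT eq_sym kj mulr0.
      by rewrite mulr0 !addr0 mulr1.
    rewrite (bigD1 l) ?li //= big1 => [|k /andP[_ /negbTE kl]]; last first.
      by rewrite !mxE ?eqxx ?andbT eq_sym kl mulr0.
    by rewrite !mxE ?eqxx ?andbT mulr0 !add0r mulr0 add0r mulr1 addr0.
  apply: memvD; first by apply/memvZ/memv_span/mem_head.
  apply: memv_suml => k kP; apply/memvZ/memv_span.
  by rewrite inE (map_f (fun k => e k)) ?orbT // mem_enum.
have nz : h (e j + a *: e i) j 0 != 0.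
  by rewrite h_coord0 !mxE ?eqxx ?andbT [j == i]eq_sym (negbTE ij) mulr0 addr0 oner_neq0.
apply: (span_coord_ratio _ (h_span vS)) => _ /mapP[w wS ->].
move: wS; rewrite inE => /predU1P[->|/mapP[k]].
  by rewrite /coord_ratio divfK.
rewrite mem_enum inE => /andP[ki kj] ->.
have h0 l : l != k -> h (e k) l 0 = 0.
  by move=> /negbTE lk; apply/eqP; rewrite h_coord0 !mxE ?eqxx ?andbT lk.
by rewrite !h0 ?mulr0 // eq_sym.
Qed.

(** The all-ones vector satisfies x_i = x_j, and so does its image, whose coordinates are
    nonzero. *)
Lemma coord_ratio1 i j : i != j -> coord_ratio i j 1 = 1.
Proof.
move=> ij; have := @coord_ratioP i j 1 (const_mx 1) ij.
rewrite !mxE ?eqxx ?andbT mulr1 => /(_ erefl); rewrite (h_normal i) (h_normal j) => /esym E.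
apply: (mulIf (x := h (const_mx 1) 0 0)); last by rewrite mul1r.
by rewrite h_coord0 mxE oner_neq0.
Qed.

(** The test vector has entry [a] at [i] and 1 at [j] and [k]. Slope 1 is preserved, so its image
    has equal entries at [j] and [k]. *)
Lemma coord_ratio_indepr i j k a : i != j -> i != k ->
  coord_ratio i j a = coord_ratio i k a.
Proof.
move=> ij ik; have [->//|jk] := eqVneq j k.
pose v := e j + e k + a *: e i.
have vi : v i 0 = a by rewrite !mxE ?eqxx ?andbT (negbTE ij) (negbTE ik) !add0r mulr1.
have vj : v j 0 = 1.
  by rewrite !mxE ?eqxx ?andbT (negbTE jk) [j == i]eq_sym (negbTE ij) mulr0 !addr0.
have vk : v k 0 = 1.
  by rewrite !mxE ?eqxx ?andbT ![k == _]eq_sym (negbTE jk) (negbTE ik)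
     mulr0 !addr0 add0r.
have hjk : h v j 0 = h v k 0.
  by rewrite (@coord_ratioP j k 1) ?coord_ratio1 ?vj ?vk ?mul1r.
have := @coord_ratioP i k a v ik; rewrite vi vk mulr1 => /(_ erefl).
rewrite (@coord_ratioP i j a v ij) ?vi ?vj ?mulr1 // hjk; apply: mulIf.
by rewrite h_coord0 vk oner_neq0.
Qed.

(** Here the test vector has entry [a] at [i] and [j], and 1 at [k]. *)
Lemma coord_ratio_indepl i j k a : i != k -> j != k ->
  coord_ratio i k a = coord_ratio j k a.
Proof.
move=> ik jk; have [->//|ij] := eqVneq i j.
pose v := e k + a *: (e i + e j).
have vi : v i 0 = a.
  by rewrite !mxE ?eqxx ?andbT (negbTE ij) (negbTE ik) !add0r addr0 mulr1.
have vj : v j 0 = a.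
  by rewrite !mxE ?eqxx ?andbT (negbTE jk) [j == i]eq_sym (negbTE ij) !add0r mulr1.
have vk : v k 0 = 1.
  by rewrite !mxE ?eqxx ?andbT ![k == _]eq_sym (negbTE ik) (negbTE jk) addr0 mulr0 addr0.
have hij : h v i 0 = h v j 0.
  by rewrite (@coord_ratioP i j 1) ?coord_ratio1 ?vi ?vj ?mul1r.
have := @coord_ratioP j k a v jk; rewrite vj vk mulr1 => /(_ erefl).
rewrite -hij (@coord_ratioP i k a v ik) ?vi ?vk ?mulr1 //; apply: mulIf.
by rewrite h_coord0 vk oner_neq0.
Qed.

Let o1 : 'I_m.+3 := inord 1.
Let o2 : 'I_m.+3 := inord 2.
Let o10 : o1 != 0. Proof. by rewrite -val_eqE /= inordK. Qed.
Let o20 : o2 != 0. Proof. by rewrite -val_eqE /= inordK. Qed.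
Let o21 : o2 != o1. Proof. by rewrite -val_eqE /= !inordK. Qed.

Definition coord_hom a := coord_ratio o1 0 a.

Lemma coord_homE i j a : i != j -> coord_ratio i j a = coord_hom a.
Proof.
have main i' j' : i' != 0 -> i' != j' -> coord_ratio i' j' a = coord_hom a.
  move=> i0 ij; rewrite (coord_ratio_indepr a ij i0).
  exact: coord_ratio_indepl.
have [->|i0] := eqVneq i 0; last exact: main.
(* For [i = 0] the first index moves to some [k] other than 0 and [j], which exists because there
   are three coordinates. *)
rewrite eq_sym => j0; pose k := if j == o1 then o2 else o1.
have [k0 kj] : k != 0 /\ k != j.
  rewrite /k; have [->|] := eqVneq j o1; first by [].
  by rewrite eq_sym.
by rewrite (@coord_ratio_indepl 0 k) ?main // eq_sym.
Qed.

Lemma coord_homP (i j : 'I_m.+3) (a : K) (v : 'cV[K]_m.+3) : i != j -> v i 0 = a * v j 0 ->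
  h v i 0 = coord_hom a * h v j 0.
Proof. by move=> ij /(coord_ratioP ij); rewrite coord_homE. Qed.

Lemma coord_hom1 : coord_hom 1 = 1.
Proof. exact: coord_ratio1. Qed.

(** On (1, b, ab) the ratio of coordinate 2 to coordinate 0 is the product of the ratios 2 to 1 and
    1 to 0; the same holds for the image. *)
Lemma coord_homM : {morph coord_hom : a b / a * b}.
Proof.
move=> a b; pose v := e 0 + b *: e o1 + (a * b) *: e o2.
have v0 : v 0 0 = 1.
  by rewrite !mxE ?eqxx ?andbT ![0 == _]eq_sym (negbTE o10) (negbTE o20) !mulr0 !addr0.
have v1 : v o1 0 = b.
  rewrite !mxE ?eqxx ?andbT (negbTE o10) [o1 == _]eq_sym (negbTE o21).
  by rewrite mulr0 !addr0 mulr1 add0r.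
have v2 : v o2 0 = a * b.
  by rewrite !mxE ?eqxx ?andbT (negbTE o20) (negbTE o21) mulr0 !add0r mulr1.
have := @coord_homP o2 0 (a * b) v o20; rewrite v2 v0 mulr1 => /(_ erefl).
rewrite (@coord_homP o2 o1 a v) ?v1 ?v2 // (@coord_homP o1 0 b v) ?v1 ?v0 ?mulr1 //.
by rewrite mulrA => /mulIf <- //; rewrite h_coord0 v0 oner_neq0.
Qed.

(* Compare the middle coordinates in [(1,a,0) + (0,b,1) = (1,a+b,1)]. *)
Lemma coord_homD : {morph coord_hom : a b / a + b}.
Proof.
move=> a b; pose u := e 0 + a *: e o1; pose w := e o2 + b *: e o1.
have u0 : u 0 0 = 1 by rewrite !mxE ?eqxx ?andbT [0 == _]eq_sym (negbTE o10) mulr0 addr0.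
have u1 : u o1 0 = a by rewrite !mxE ?eqxx ?andbT (negbTE o10) mulr1 add0r.
have u2 : u o2 0 = 0 by rewrite !mxE ?eqxx ?andbT (negbTE o20) (negbTE o21) mulr0 addr0.
have w0 : w 0 0 = 0.
  by rewrite !mxE ?eqxx ?andbT ![0 == _]eq_sym (negbTE o10) (negbTE o20) mulr0 addr0.
have w1 : w o1 0 = b by rewrite !mxE ?eqxx ?andbT [o1 == _]eq_sym (negbTE o21) mulr1 add0r.
have w2 : w o2 0 = 1 by rewrite !mxE ?eqxx ?andbT (negbTE o21) mulr0 addr0.
have x0 : (u + w) 0 0 = 1 by rewrite mxE u0 w0 addr0.
have x1 : (u + w) o1 0 = a + b by rewrite mxE u1 w1.
have x2 : (u + w) o2 0 = 1 by rewrite mxE u2 w2 add0r.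
have : u + w \in <<[:: u; w]>>%VS by rewrite memvD // memv_span ?inE ?eqxx ?orbT.
move/h_span; rewrite /= span_cons span_seq1 => /memv_addP[_ /vlineP[c ->] [_ /vlineP[d ->]]].
have hu2 : h u o2 0 = 0 by apply/eqP; rewrite h_coord0 u2.
have hw0 : h w 0 0 = 0 by apply/eqP; rewrite h_coord0 w0.
have hu1 := @coord_homP o1 0 a u o10; rewrite u0 u1 mulr1 in hu1.
have hw1 := @coord_homP o1 o2 b w; rewrite eq_sym w1 w2 mulr1 in hw1.
have hx1 := @coord_homP o1 0 (a + b) (u + w) o10; rewrite x0 x1 mulr1 in hx1.
have hx2 := @coord_homP o2 0 1 (u + w) o20; rewrite x0 x2 mulr1 coord_hom1 mul1r in hx2.
move=> E.
(* Coordinate 0 sees only [c *: h u] and coordinate 2 only [d *: h w]. Both entries of [h (u + w)]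
   are equal by [hx2], so its middle entry is their common value times the sum of the two slopes. *)
have E0 : h (u + w) 0 0 = c * h u 0 0 by rewrite E !mxE ?eqxx ?andbT hw0 mulr0 addr0.
have E2 : h (u + w) o2 0 = d * h w o2 0 by rewrite E !mxE ?eqxx ?andbT hu2 mulr0 add0r.
have E1 : h (u + w) o1 0 = c * h u o1 0 + d * h w o1 0 by rewrite E !mxE ?eqxx ?andbT.
apply: (mulIf (x := h (u + w) 0 0)); first by rewrite h_coord0 x0 oner_neq0.
rewrite -(hx1 erefl) E1 (hu1 erefl) (hw1 o21 erefl) mulrDl {1}E0 -(hx2 erefl) E2.
by rewrite !(mulrCA c) !(mulrCA d).
Qed.

(** The hypotheses on [h] survive a nonzero rescaling of each value, hence a scalar depending on
    [v]. A nonzero coordinate of [v] determines it, and [coord_hom] carries the ratios of the other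
    coordinates to that one. *)
Lemma normalized_collineation : exists f : {rmorphism K -> K},
  forall v, exists2 c, c != 0 & h v = c *: map_mx f v.
Proof.
have [||f fE] := @exists_rmorphism _ _ coord_hom.
- move=> a b; apply: (addIr (coord_hom b)).
  by rewrite -coord_homD !subrK.
- by split; [exact: coord_hom1 | exact: coord_homM].
exists f => v.
have [->|/cV0Pn[j vj]] := eqVneq v 0.
  exists 1; rewrite ?oner_neq0 // map_mx0 scaler0; apply/colP => i.
  by rewrite mxE; apply/eqP; rewrite h_coord0 mxE.
have fvj : f (v j 0) != 0 by rewrite fmorph_eq0.
exists (h v j 0 / f (v j 0)); first by rewrite mulf_neq0 ?invr_eq0 ?h_coord0.
apply/colP => i; rewrite !mxE ?eqxx ?andbT.
have [->|ij] := eqVneq i j; first by rewrite divfK.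
rewrite (@coord_homP i j (v i 0 / v j 0)) ?divfK // -fE fmorph_div.
by rewrite mulrAC [RHS]mulrAC [f _ * _]mulrC.
Qed.

End NormalizedCollineation.

(** * Reduction of a general collineation to a normalized one *)

Lemma mem_span_mulmx (K : fieldType) n (M : 'M[K]_n) (u : 'cV[K]_n) S :
  u \in <<S>>%VS -> M *m u \in <<map (mulmx M) S>>%VS.
Proof.
move=> /(@coord_span _ _ _ (in_tuple S)) ->.
rewrite mulmx_sumr memv_suml // => k _.
by rewrite -scalemxAr memvZ // memv_span // map_f // mem_nth.
Qed.

Section Collineation.

Variables (K : fieldType) (m : nat) (g : 'cV[K]_m.+3 -> 'cV[K]_m.+3).
Hypothesis g_span : forall v S, (g v \in <<map g S>>%VS) = (v \in <<S>>%VS).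

Local Notation e i := (delta_mx i 0 : 'cV[K]_m.+3).

(** Turns the vanishing of a coordinate into membership in a span, which is what [g_span]
    transports. *)
Lemma mem_coord_hyperplane i (v : 'cV[K]_m.+3) :
  (v \in <<[seq e k | k <- enum (predC1 i)]>>%VS) = (v i 0 == 0).
Proof.
apply/idP/eqP => [vS|v0].
  rewrite -[RHS](mul0r (v i 0)); apply: (span_coord_ratio _ vS).
  move=> _ /mapP[k + ->]; rewrite mem_enum inE => /negbTE ki.
  by rewrite !mxE eq_sym ki mul0r.
have -> : v = \sum_(k | k != i) v k 0 *: e k.
  apply/colP => l; rewrite summxE.
  have [->|li] := eqVneq l i.
    by rewrite v0 big1 // => k /negbTE ki; rewrite !mxE eq_sym ki mulr0.
  rewrite (bigD1 l) //= big1 => [|k /andP[_ /negbTE kl]]; last first.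
    by rewrite !mxE eq_sym kl mulr0.
  by rewrite !mxE !eqxx mulr1 addr0.
apply: memv_suml => k ki; apply/memvZ/memv_span/map_f.
by rewrite mem_enum.
Qed.

Let A0 : 'M[K]_m.+3 := \matrix_(i, j) g (e j) i 0.

Let A0e j : A0 *m e j = g (e j).
Proof. by rewrite -colE; apply/colP => i; rewrite !mxE. Qed.

(** A kernel vector with nonzero entry [j] would put [g (e j)] in the span of the other [g (e k)],
    hence by [g_span] [e j] in the span of the other basis vectors. *)
Let A0_unit : A0 \in unitmx.
Proof.
rewrite unitmxE unitfE -det_tr; apply/det0P => -[x /rV0Pn[j xj]].
move=> /(congr1 trmx); rewrite trmx_mul trmxK trmx0 => E.
have : g (e j) \in <<map g [seq e k | k <- enum (predC1 j)]>>%VS.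
  have : x 0 j *: g (e j) + \sum_(k | k != j) x 0 k *: g (e k) = 0.
    rewrite -[RHS]E -(bigD1 j (P := predT) (F := fun k => x 0 k *: g (e k))) //=.
    by apply/colP => i; rewrite summxE mxE; apply: eq_bigr => k _; rewrite !mxE mulrC.
  move=> /(canRL (addrK _)); rewrite sub0r => /(canRL (scalerK xj)) ->.
  rewrite memvZ // memvN memv_suml // => k kj; rewrite memvZ // memv_span //.
  by do 2!apply: map_f; rewrite mem_enum.
by rewrite g_span mem_coord_hyperplane mxE !eqxx oner_eq0.
Qed.

Let h0 v := invmx A0 *m g v.

Let h0_span v S : (h0 v \in <<map h0 S>>%VS) = (v \in <<S>>%VS).
Proof.
rewrite -g_span; apply/idP/idP => [/(mem_span_mulmx A0)|/(mem_span_mulmx (invmx A0))].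
  by rewrite mulKVmx // -map_comp (eq_map (fun u => mulKVmx A0_unit (g u))).
by rewrite -map_comp.
Qed.

(** [h0] fixes every [e k] and respects spans, so it preserves each coordinate hyperplane. *)
Let h0_coord0 v i : (h0 v i 0 == 0) = (v i 0 == 0).
Proof.
rewrite -!mem_coord_hyperplane -(h0_span v) -map_comp; congr (_ \in <<_>>%VS).
by apply: eq_map => k; rewrite /= /h0 -A0e mulKmx.
Qed.

Lemma collineation_semilinear :
  exists2 A : 'M[K]_m.+3, A \in unitmx & exists f : {rmorphism K -> K},
  forall v, exists2 c, c != 0 & g v = c *: (A *m map_mx f v).
Proof.
(* [w] has no zero entry, so [invmx D] exists and takes [w] back to the all-ones vector; this
   normalizes [h]. *)
pose w := h0 (const_mx 1); pose D := diag_mx w^T.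
have wN0 i : w i 0 != 0 by rewrite h0_coord0 mxE oner_neq0.
have D_unit : D \in unitmx.
  rewrite unitmxE det_diag unitfE; apply/prodf_neq0 => i _.
  by rewrite mxE.
have A_unit : A0 *m D \in unitmx by rewrite unitmx_mul A0_unit.
pose h v := invmx D *m h0 v.
have hE v i : h0 v i 0 = w i 0 * h v i 0.
  rewrite -[h0 v](mulKVmx D_unit) -/(h v) mul_diag_mx !mxE //.
have [|||f fP] := @normalized_collineation K m h.
- move=> v S; rewrite -(h0_span v) => /(mem_span_mulmx (invmx D)).
  by rewrite -map_comp.
- by move=> v i; rewrite -(h0_coord0 v) hE mulf_eq0 (negbTE (wN0 i)).
- have h1 i : h (const_mx 1) i 0 = 1.
    by apply: (mulfI (wN0 i)); rewrite -hE mulr1.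
  by move=> i; rewrite !h1.
exists (A0 *m D) => //; exists f => v; have [c c0 E] := fP v.
exists c => //; rewrite scalemxAr -E /h -mulmxA mulKVmx // /h0 mulKVmx //.
Qed.

End Collineation.

(** * From lattice automorphisms to maps on vectors *)

Section LatticeAutomorphism.

Variables (K : fieldType) (vT : vectType K) (phi : {vspace vT} -> {vspace vT}).
Hypothesis phi_le : forall U W, (phi U <= phi W)%VS = (U <= W)%VS.
Hypothesis phi_surj : forall W, exists U, phi U = W.

Lemma lattice_aut0 : phi 0 = 0%VS.
Proof.
have [U U0] := phi_surj 0; apply/eqP.
by rewrite -subv0 -[X in (_ <= X)%VS]U0 phi_le sub0v.
Qed.

(** The sum is the least upper bound, which an order isomorphism preserves. *)
Lemma lattice_autD U W : phi (U + W) = (phi U + phi W)%VS.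
Proof.
have [X XE] := phi_surj (phi U + phi W).
apply/eqP; rewrite eqEsubv subv_add !phi_le addvSl addvSr andbT -XE phi_le.
by rewrite subv_add -(phi_le U) -(phi_le W) XE addvSl addvSr.
Qed.

(** An arbitrary representative of the image of a line; no compatibility of scalars is imposed. *)
Definition point_image (v : vT) : vT := vpick (phi <[v]>).

Lemma lattice_aut_line v : phi <[v]> = <[point_image v]>%VS.
Proof.
rewrite /point_image; set w := vpick _.
have [w0|wN0] := eqVneq w 0.
  have /eqP -> : phi <[v]> == 0%VS by rewrite -vpick0 -/w w0.
  by rewrite w0; apply/esym/eqP; rewrite -dimv_eq0 dim_vline eqxx.
(* The preimage [X] of [<[w]>] is a nonzero subspace of [<[v]>], hence all of it. *)
have [X XE] := phi_surj <[w]>.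
have Xv : (X <= <[v]>)%VS by rewrite -phi_le XE -memvE memv_pick.
rewrite -XE; congr phi; apply/eqP.
rewrite eq_sym eqEdim Xv dim_vline (leq_trans (leq_b1 _)) // lt0n dimv_eq0.
by apply: contraNneq wN0 => X0; rewrite -memv0 -[0%VS]lattice_aut0 -X0 XE memv_line.
Qed.

Lemma lattice_aut_span S : phi <<S>> = <<map point_image S>>%VS.
Proof.
elim: S => [|v S IHS] /=; first by rewrite span_nil lattice_aut0.
by rewrite !span_cons lattice_autD IHS lattice_aut_line.
Qed.

(** Provides for [point_image] the hypothesis of [collineation_semilinear]. *)
Lemma mem_span_point_image v S :
  (point_image v \in <<map point_image S>>%VS) = (v \in <<S>>%VS).
Proof. by rewrite memvE -lattice_aut_line -lattice_aut_span phi_le -memvE. Qed.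

End LatticeAutomorphism.

(** Absorbs the vector-dependent scalars of [collineation_semilinear]. *)
Lemma eq_span_map (K : fieldType) (vT : vectType K) (T : Type) (g k : T -> vT) s :
  (forall x, <[g x]> = <[k x]>)%VS -> (<<map g s>> = <<map k s>>)%VS.
Proof. by move=> E; elim: s => //= x s IHs; rewrite !span_cons E IHs. Qed.

(** * Graph automorphisms as lattice automorphisms *)

Section GraphAutomorphism.

Variables (F : finFieldType) (n : nat) (s : vertex F n -> vertex F n).
Hypothesis s_aut : graph_automorphism s.

(** [vertex_le] expresses inclusion through adjacency; by surjectivity of [s] its values run over
    all test vertices. *)
Lemma graph_automorphism_le U1 U2 :
  (val (s U1) <= val (s U2))%VS = (val U1 <= val U2)%VS.
Proof.
have [[s' sK s'K] sA] := s_aut.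
apply/idP/idP => /vertex_le H; apply/vertex_le => U.
  by rewrite -(sA U1) -(sA U2); apply: H.
by rewrite -[U]s'K !sA; apply: H.
Qed.

(** Adding the zero and the full subspace as fixed points gives a map on the whole subspace
    lattice. *)
Definition subspace_ext (W : {vspace 'cV[F]_n}) : {vspace 'cV[F]_n} :=
  if insub W is Some U then val (s U) else W.

Lemma subspace_ext_val U : subspace_ext (val U) = val (s U).
Proof. by rewrite /subspace_ext valK. Qed.

Lemma subspace_ext_trivial W : ~~ ((W != 0%VS) && (W != fullv)) -> subspace_ext W = W.
Proof. by move=> H; rewrite /subspace_ext insubN. Qed.

Lemma vertex_dichotomy (W : {vspace 'cV[F]_n}) :
  (exists U : vertex F n, W = val U) \/ ~~ ((W != 0%VS) && (W != fullv)).
Proof.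
case: (boolP ((W != 0%VS) && (W != fullv))) => H; last by right.
by left; exists (exist _ W H).
Qed.

Lemma vertex_sub0 (U : vertex F n) : (val U <= 0)%VS = false.
Proof. by rewrite subv0; have /andP[/negbTE] := valP U. Qed.

Lemma full_sub_vertex (U : vertex F n) : (fullv <= val U)%VS = false.
Proof.
have /andP[_ /negbTE E] := valP U; apply/negbTE/negP => H.
by move/negP: E; apply; rewrite eqEsubv subvf.
Qed.

Lemma subspace_ext_le W1 W2 :
  (subspace_ext W1 <= subspace_ext W2)%VS = (W1 <= W2)%VS.
Proof.
case: (vertex_dichotomy W1) => [[U1 ->]|H1]; case: (vertex_dichotomy W2) => [[U2 ->]|H2].
- by rewrite !subspace_ext_val graph_automorphism_le.
- rewrite subspace_ext_val (subspace_ext_trivial H2).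
  move: H2; rewrite negb_and !negbK => /orP[]/eqP ->.
    by rewrite !vertex_sub0.
  by rewrite !subvf.
- rewrite subspace_ext_val (subspace_ext_trivial H1).
  move: H1; rewrite negb_and !negbK => /orP[]/eqP ->.
    by rewrite !sub0v.
  by rewrite !full_sub_vertex.
- by rewrite !subspace_ext_trivial.
Qed.

Lemma subspace_ext_surj W : exists U, subspace_ext U = W.
Proof.
case: (vertex_dichotomy W) => [[U ->]|H]; last first.
  by exists W; apply: subspace_ext_trivial.
have [[s' sK s'K] _] := s_aut.
by exists (val (s' U)); rewrite subspace_ext_val s'K.
Qed.

Lemma graph_automorphism_points : exists g : 'cV[F]_n -> 'cV[F]_n,
  (forall v S, (g v \in <<map g S>>%VS) = (v \in <<S>>%VS)) /\
  (forall U, val (s U) = vimage g (val U)).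
Proof.
exists (point_image subspace_ext); split.
  exact: mem_span_point_image subspace_ext_le subspace_ext_surj.
move=> U; rewrite -subspace_ext_val /vimage.
rewrite -(lattice_aut_span subspace_ext_le subspace_ext_surj); congr subspace_ext.
(* As [F] is finite, [U] is spanned by the list of all its vectors, to which [lattice_aut_span]
   applies. *)
apply/vspaceP => v; apply/idP/idP => [vU|].
  by apply: memv_span; rewrite mem_enum.
by move: v; apply/subvP/span_subvP => v; rewrite mem_enum.
Qed.

End GraphAutomorphism.

Lemma graph_automorphism_sigma (F : finFieldType) (n : nat) (hn : (3 <= n)%N)
    (s : vertex F n -> vertex F n) :
  graph_automorphism s ->
  exists (A : 'M[F]_n) (hA : A \in unitmx)
         (f : {rmorphism F -> F}) (hf : bijective f),
    s =1 sigma_mx hA \o sigma_aut hf.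
Proof.
case: n hn s => [|[|[|m]]] // _ s /graph_automorphism_points[g [g_span sE]].
have [A hA [f fP]] := collineation_semilinear g_span.
(* A field endomorphism is injective, hence bijective because [F] is finite. *)
have hf : bijective f by apply/injF_bij/fmorph_inj.
exists A, hA, f, hf => U; apply: val_inj.
rewrite sE /= (vimage_comp _ _ hf (vec_aut_semilinear f)).
apply: eq_span_map => v /=; have [c c0 ->] := fP v.
apply/eqP; rewrite eqEsubv -!memvE memvZ ?memv_line //.
by rewrite -[X in X \in _](scalerK c0) memvZ ?memv_line.
Qed.

(** * Uniqueness of the decomposition *)

Section Uniqueness.

Variables (F : finFieldType) (n : nat).

Lemma line_vertex (v : 'cV[F]_n) : (1 < n)%N -> v != 0 ->
  (<[v]>%VS != 0%VS) && (<[v]>%VS != fullv).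
Proof.
move=> n1 v0; rewrite -!dimv_eq0 dim_vline v0 /=.
apply: contraTneq n1 => /(congr1 (fun W => \dim W)).
by rewrite dim_vline v0 dimvf /dim /= muln1 => <-.
Qed.

Lemma mulmx_mem_sigma_mx (A : 'M[F]_n) (hA : A \in unitmx) U v :
  (A *m v \in val (sigma_mx hA U)) = (v \in val U).
Proof.
rewrite mem_sigma_mx; apply/imsetP/idP => [[w wU /(can_inj (mulKmx hA)) ->]|vU] //.
by exists v.
Qed.

(** The eigenvectors e_i make [M] diagonal; the all-ones vector then shows every diagonal entry to
    be [c]. *)
Lemma scalar_mx_of_eigen (M : 'M[F]_n) c :
  (forall i, exists a, M *m delta_mx i 0 = a *: delta_mx i 0 :> 'cV_n) ->
  M *m const_mx 1 = c *: const_mx 1 :> 'cV_n -> M = c%:M.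
Proof.
move=> Me M1.
have Mij i j : i != j -> M i j = 0.
  move=> /negbTE ij; have [a /colP/(_ i)] := Me j.
  by rewrite -colE !mxE ij mulr0.
apply/matrixP => i j; rewrite mxE; have [->|/Mij //] := eqVneq i j.
move/colP/(_ j): M1; rewrite !mxE mulr1 mulr1n => <-.
rewrite (bigD1 j) //= big1 => [|k kj]; first by rewrite mxE mulr1 addr0.
by rewrite Mij ?mul0r // eq_sym.
Qed.

Lemma sigma_comp_inj (A1 A2 : 'M[F]_n) (hA1 : A1 \in unitmx) (hA2 : A2 \in unitmx)
    (f1 f2 : {rmorphism F -> F}) (hf1 : bijective f1) (hf2 : bijective f2) :
  (1 < n)%N ->
  sigma_mx hA1 \o @sigma_aut F n f1 hf1 =1 sigma_mx hA2 \o @sigma_aut F n f2 hf2 ->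
  sigma_mx hA1 =1 sigma_mx hA2 /\
  @sigma_aut F n f1 hf1 =1 @sigma_aut F n f2 hf2.
Proof.
move=> n1 E.
(* A nonzero vector fixed by [f1] and [f2] spans a line with the same image under [A1] and [A2].
   This applies to the e_i and to the all-ones vector. *)
have eigen (v : 'cV[F]_n) : v != 0 -> map_mx f1 v = v -> map_mx f2 v = v ->
    exists a, invmx A2 *m A1 *m v = a *: v.
  move=> v0 f1v f2v; pose U : vertex F n := exist _ <[v]>%VS (line_vertex n1 v0).
  have : A1 *m v \in val (sigma_mx hA1 (sigma_aut hf1 U)).
    rewrite mulmx_mem_sigma_mx mem_sigma_aut; apply/imsetP.
    by exists v; rewrite ?memv_line.
  have EU : sigma_mx hA1 (sigma_aut hf1 U) = sigma_mx hA2 (sigma_aut hf2 U) := E U.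
  rewrite EU.
  rewrite mem_sigma_mx => /imsetP[w]; rewrite mem_sigma_aut => /imsetP[u].
  move=> /vlineP[k ->] ->; rewrite map_mxZ f2v => Av.
  by exists (f2 k); rewrite -mulmxA Av mulKmx.
have fe (f : {rmorphism F -> F}) i : map_mx f (delta_mx i 0 : 'cV_n) = delta_mx i 0.
  by apply/matrixP => k l; rewrite !mxE rmorph_nat.
have f1m (f : {rmorphism F -> F}) : map_mx f (const_mx 1 : 'cV_n) = const_mx 1.
  by apply/matrixP => k l; rewrite !mxE rmorph1.
have n0 : (0 < n)%N by apply: ltnW.
have [|||c Mc] := eigen (const_mx 1); rewrite ?f1m //.
  by apply/cV0Pn; exists (Ordinal n0); rewrite mxE oner_neq0.
have A12 : A1 = c *: A2.
  rewrite -[A1](mulKVmx hA2) (scalar_mx_of_eigen _ Mc) ?mul_mx_scalar // => i.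
  have [|||a aE] := eigen (delta_mx i 0); rewrite ?fe //; last by exists a.
  by apply/cV0Pn; exists i; rewrite mxE !eqxx oner_neq0.
have c0 : c != 0.
  apply/eqP => c0; have : (const_mx 1 : 'cV[F]_n) = 0.
    by rewrite -(mulKmx hA1 (const_mx 1)) A12 c0 scale0r mul0mx mulmx0.
  by move/colP/(_ (Ordinal n0))/eqP; rewrite !mxE oner_eq0.
have EA : sigma_mx hA1 =1 sigma_mx hA2.
  move=> U; apply/val_inj/vspaceP => v; rewrite -[v](mulKVmx hA2).
  rewrite mulmx_mem_sigma_mx; set w := invmx A2 *m v.
  have -> : A2 *m w = A1 *m (c^-1 *: w).
    by rewrite A12 -scalemxAl -scalemxAr scalerA mulfV // scale1r.
  by rewrite mulmx_mem_sigma_mx rpredZeq invr_eq0 (negbTE c0).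
(* The matrix parts now agree and, being invertible, cancel from [E]. *)
split=> // U; apply/val_inj/vspaceP => v.
have EU : sigma_mx hA1 (sigma_aut hf1 U) = sigma_mx hA2 (sigma_aut hf2 U) := E U.
by rewrite -[LHS](mulmx_mem_sigma_mx hA1) EU -EA mulmx_mem_sigma_mx.
Qed.

End Uniqueness.

Theorem theorem3p1 (F : finFieldType) (n : nat) (hn : (3 <= n)%N) :
  (forall s : vertex F n -> vertex F n,
     graph_automorphism s <->
     exists (A : 'M[F]_n) (hA : A \in unitmx)
            (f : {rmorphism F -> F}) (hf : bijective f),
       s =1 sigma_mx hA \o sigma_aut hf)
  /\
  (forall (A1 A2 : 'M[F]_n) (hA1 : A1 \in unitmx) (hA2 : A2 \in unitmx)
          (f1 f2 : {rmorphism F -> F}) (hf1 : bijective f1) (hf2 : bijective f2),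
     sigma_mx hA1 \o @sigma_aut F n f1 hf1 =1 sigma_mx hA2 \o @sigma_aut F n f2 hf2 ->
     sigma_mx hA1 =1 sigma_mx hA2 /\
     @sigma_aut F n f1 hf1 =1 @sigma_aut F n f2 hf2).
Proof.
split=> [s|A1 A2 hA1 hA2 f1 f2 hf1 hf2]; last exact: sigma_comp_inj (ltnW hn).
split=> [|[A [hA [f [hf sE]]]]]; first exact: graph_automorphism_sigma.
have [B adjE] := sigma_comp_automorphism hA hf; split.
  exact: eq_bij B _ (fsym sE).
by move=> U1 U2; rewrite !sE.
Qed.
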